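(* Let $b\ge 2$ and let $u\in U_{2,b}^E$ be even. Then there exist arbitrarily long finite sequences of consecutive $u$-attracted numbers for $E_{2,b}$; that is, for every $L\in\mathbb{Z}^+$ there are $L$ consecutive positive integers all of which are $u$-attracted numbers for $E_{2,b}$.
   Context: For a base $b\ge 2$, every $a\in\mathbb{Z}^+$ has a base $b$ expansion $a=\sum_{i=0}^n a_ib^i$ with $0\le a_i<b$ and leading digit $a_n\ne 0$. The $b$-elated function $E_{2,b}:\mathbb{Z}^+\to\mathbb{Z}^+$ is defined by $E_{2,b}(a)=a_n\sum_{i=0}^n a_i^2$. Powers $E_{2,b}^k$ denote iteration. $U_{2,b}^E=\{a\in\mathbb{Z}^+ \mid E_{2,b}^m(a)=a \text{ for some } m\in\mathbb{Z}^+\}$ is the set of all numbers in cycles of $E_{2,b}$. For $u\in U_{2,b}^E$, a number $a\in\mathbb{Z}^+$ is a $u$-attracted number for $E_{2,b}$ if $E_{2,b}^k(a)=u$ for some $k\in\mathbb{Z}^+$. *)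

(* Defs.v *)
From mathcomp Require Import all_boot.

Set Implicit Arguments.
Unset Strict Implicit.
Unset Printing Implicit Defensive.

(* Positive integers are the [a : nat] with [0 < a]; the functions below are
   total on nat, and their values at [a = 0] or for [b < 2] are irrelevant. *)

(* Coefficient of [b ^ i] in the base [b] expansion of [a]. *)
Definition digit (b a i : nat) : nat := (a %/ b ^ i) %% b.

(* Since [trunc_log b a] is the largest [n] with [b ^ n <= a], it is the index
   of the leading digit of [a > 0]; see [base_expansion] and
   [base_expansion_unique]. *)
Definition top_index (b a : nat) : nat := trunc_log b a.

Definition elated (b a : nat) : nat :=
  digit b a (top_index b a) * \sum_(i < (top_index b a).+1) digit b a i ^ 2.

Definition in_cycle (b u : nat) : Prop :=
  0 < u /\ exists2 m, 0 < m & iter m (elated b) u = u.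

Definition attracted (b u a : nat) : Prop :=
  0 < a /\ exists2 k, 0 < k & iter k (elated b) a = u.

Lemma digit_lt b a i : 1 < b -> digit b a i < b.
Proof. by move=> b1; rewrite ltn_mod ltnW. Qed.

Lemma sum_digits b a n :
  a = \sum_(i < n) digit b a i * b ^ i + a %/ b ^ n * b ^ n.
Proof.
elim: n => [|n IHn]; first by rewrite big_ord0 divn1 muln1.
rewrite big_ord_recr /= -addnA {1}IHn; congr addn.
by rewrite /digit expnSr divnMA (mulnC (b ^ n)) mulnA -mulnDl addnC -divn_eq.
Qed.

Lemma base_expansion b a : 1 < b -> 0 < a ->
  [/\ a = \sum_(i < (top_index b a).+1) digit b a i * b ^ i,
      forall i, digit b a i < b
    & digit b a (top_index b a) != 0].
Proof.
move=> b1 a0; have /andP[le_a lt_a] := trunc_log_bounds b1 a0.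
have bn0 : 0 < b ^ top_index b a by rewrite expn_gt0 (ltnW b1).
split=> [|i|]; first 1 last.
- exact: digit_lt.
- rewrite /digit modn_small; first by rewrite -lt0n divn_gt0.
  by rewrite ltn_divLR // -expnS.
- by rewrite {1}(sum_digits b a (top_index b a).+1) (divn_small lt_a) mul0n addn0.
Qed.

Lemma sum_digits_lt b n (c : nat -> nat) : (forall i, c i < b) ->
  \sum_(i < n) c i * b ^ i < b ^ n.
Proof.
move=> c_lt; elim: n => [|n IHn]; first by rewrite big_ord0.
rewrite big_ord_recr /= expnS; apply: (@leq_trans ((c n).+1 * b ^ n)).
  by rewrite mulSn ltn_add2r.
by rewrite leq_mul2r c_lt orbT.
Qed.

Lemma base_expansion_unique b a n (c : nat -> nat) : 1 < b ->
  a = \sum_(i < n.+1) c i * b ^ i -> (forall i, c i < b) -> c n != 0 ->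
  n = top_index b a /\ forall i, i <= n -> c i = digit b a i.
Proof.
move=> b1 def_a c_lt cn0; have b0 := ltnW b1; split.
  apply/esym/trunc_log_eq => //; rewrite def_a sum_digits_lt // andbT.
  rewrite big_ord_recr /=; apply: leq_trans (leq_addl _ _).
  by rewrite leq_pmull // lt0n.
rewrite {}def_a {cn0}.
elim: n c c_lt => [|n IHn] c c_lt [|i] // le_i.
- by rewrite big_ord1 /digit divn1 muln1 modn_small.
- rewrite /digit divn1 big_ord_recl /= muln1.
  under eq_bigr do rewrite /bump /= expnSr mulnA.
  by rewrite -big_distrl /= addnC modnMDl modn_small.
rewrite /digit big_ord_recl /= muln1.
under eq_bigr do rewrite /bump /= expnSr mulnA.
rewrite -big_distrl /= expnS divnMA addnC divnMDl // (divn_small (c_lt 0)) addn0.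
exact: (IHn (fun i => c i.+1)).
Qed.

(* Main.v *)
Require Import Defs.
From mathcomp Require Import all_boot.
From mathcomp Require Import zify.

(** Write [S] for the sum of the squares of the base [b] digits.  A number
    with leading digit [1] is sent by [elated b] to its [S].  If [c > 0] and a
    block of [c] digits [1] is put at the same place above the digits of
    finitely many numbers [t], a common translation, then the results are sent
    to [S t + c] ([elated_pad]).  So if a common translation makes all the
    [S t + 1] attracted, then a common translation makes all the [t] attracted
    ([translatable_image]).

    Finite sets are therefore handled by collapsing them with maps of the form
    [t |-> S (t + m) + 1].  Two maps of this kind suffice to identify two
    given numbers: the first makes them congruent modulo [b - 1]
    ([sumsq_shift_congr]), and the second one makes them equal
    ([sumsq_shift_eq]), because numbers whose difference is [(b - 1) v] can be
    translated to [b ^ r + b v] and [b ^ r + v], which have the same nonzero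
    digits.  What remains at the end is a single number, and it can be
    translated to one made of [u] digits [1] and of zeros, whose image is [u].

    If [b] is odd, then [S t] and [t] have the same parity, and only numbers of
    the same parity can be identified.  Here [b >= 3], and the leading digit
    [2] doubles [S]: a first step with that leading digit makes all images
    even.  The constant added to the images by this step is even too, so the
    translation of the images that makes them attracted has to be even.
    Therefore the parity of the translated numbers is controlled along the
    whole process, which ends on a number made of [u] digits [1] and of zeros;
    this number is even because [u] is. *)

(** * Sums of squared digits *)

(** The number [a] itself is a convenient bound for the number of digits of
    [a]; [sumsqE] replaces it by any other one. *)
Definition sumsq (b a : nat) : nat := \sum_(i < a) digit b a i ^ 2.

Lemma digit_high b a i : a < b ^ i -> digit b a i = 0.
Proof. by move=> lt_a; rewrite /digit divn_small // mod0n. Qed.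

Lemma sum_digits_widen b a n k : 1 < b -> a < b ^ n ->
  \sum_(i < n + k) digit b a i ^ 2 = \sum_(i < n) digit b a i ^ 2.
Proof.
move=> b1 lt_a; rewrite big_split_ord /= [X in _ + X]big1 ?addn0 // => i _.
rewrite digit_high //; apply: leq_trans lt_a _.
by rewrite leq_exp2l // leq_addr.
Qed.

Lemma sumsqE b a n : 1 < b -> a < b ^ n ->
  sumsq b a = \sum_(i < n) digit b a i ^ 2.
Proof.
move=> b1 lt_a; rewrite /sumsq -(sum_digits_widen _ _ _ n b1 (ltn_expl a b1)).
by rewrite addnC sum_digits_widen.
Qed.

Lemma sumsq_digit b d : d < b -> sumsq b d = d ^ 2.
Proof.
case: d => [|d] lt_d; first by rewrite /sumsq big_ord0.
have b1 : 1 < b by apply: leq_ltn_trans lt_d.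
by rewrite (@sumsqE _ _ 1) ?expn1 // big_ord1 /digit divn1 modn_small.
Qed.

Lemma sumsq_cat b r x y : 1 < b -> x < b ^ r ->
  sumsq b (x + b ^ r * y) = sumsq b x + sumsq b y.
Proof.
move=> b1 lt_x; have lt_y : y < b ^ y by apply: ltn_expl.
have br0 : 0 < b ^ r by rewrite expn_gt0 ltnW.
rewrite (@sumsqE _ _ (r + y)) //; last first.
  by rewrite expnD; nia.
rewrite big_split_ord /=; congr (_ + _).
  rewrite (@sumsqE _ _ r) //; apply: eq_bigr => i _; congr (_ ^ 2).
  have -> : b ^ r = b ^ (r - i.+1) * b * b ^ i.
    by rewrite -mulnA -expnS -expnD subnK.
  rewrite /digit mulnAC addnC divnMDl ?expn_gt0 ?(ltnW b1) //.
  by rewrite mulnAC modnMDl.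
apply: eq_bigr => i _; congr (_ ^ 2).
by rewrite /digit expnD divnMA addnC mulnC divnMDl // (divn_small lt_x) addn0.
Qed.

Lemma odd_sumsq b a : 1 < b -> odd b -> odd (sumsq b a) = odd a.
Proof.
move=> b1 ob; elim/ltn_ind: a => a IH.
case: (posnP a) => [->|a0]; first by rewrite /sumsq big_ord0.
have lt_r : a %% b < b ^ 1 by rewrite expn1 ltn_mod ltnW.
have ea : a = a %% b + b ^ 1 * (a %/ b) by rewrite expn1 addnC mulnC -divn_eq.
rewrite [in LHS]ea [in RHS]ea sumsq_cat // sumsq_digit ?ltn_mod ?(ltnW b1) //.
by rewrite expn1 !oddD oddX IH ?ltn_Pdiv // oddM ob.
Qed.

Lemma elated_lead b r x d : 1 < b -> x < b ^ r -> 0 < d < b ->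
  elated b (x + b ^ r * d) = d * (sumsq b x + d ^ 2).
Proof.
move=> b1 lt_x /andP[d0 lt_d].
have br0 : 0 < b ^ r by rewrite expn_gt0 ltnW.
have lt_a : x + b ^ r * d < b ^ r.+1 by rewrite expnSr; nia.
have top : top_index b (x + b ^ r * d) = r.
  by apply: trunc_log_eq; rewrite // lt_a andbT; nia.
rewrite /elated top -(@sumsqE _ _ r.+1) // sumsq_cat // (@sumsq_digit _ d) //.
congr (_ * _); rewrite /digit addnC mulnC divnMDl // (divn_small lt_x) addn0.
exact: modn_small.
Qed.

(** * Padding with a leading block *)

Definition repunit (b n : nat) : nat := \sum_(i < n) b ^ i.

(** Above [m] zeros: [c] digits [1], then the leading digit [d]. *)
Definition pad (b m c d : nat) : nat := b ^ m * (repunit b c + b ^ c * d).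

Lemma repunit_lt b n : 1 < b -> repunit b n < b ^ n.
Proof.
move=> b1; have := @sum_digits_lt b n (fun=> 1) (fun=> b1).
by under eq_bigr do rewrite mul1n.
Qed.

Lemma sumsq_repunit b n : 1 < b -> sumsq b (repunit b n) = n.
Proof.
move=> b1; elim: n => [|n IHn].
  by rewrite /repunit big_ord0 /sumsq big_ord0.
rewrite /repunit big_ord_recr /= -[b ^ n]muln1 sumsq_cat ?repunit_lt //.
by rewrite IHn sumsq_digit // addn1.
Qed.

Lemma odd_pad b m c d : odd b -> odd (pad b m c d) = odd (c + d).
Proof.
move=> ob; have oX n : odd (b ^ n) by rewrite oddX ob orbT.
rewrite /pad oddM oX /= !oddD oddM oX /=; congr (_ (+) _).
elim: c => [|c IHc]; first by rewrite /repunit big_ord0.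
by rewrite /repunit big_ord_recr oddD IHc oX addbT.
Qed.

Lemma leq_exp_pad b m c d : 1 < b -> 0 < d -> b ^ m <= pad b m c d.
Proof.
move=> b1 d0; rewrite leq_pmulr // addn_gt0 muln_gt0 d0 andbT.
by rewrite expn_gt0 (ltnW b1) orbT.
Qed.

Lemma elated_pad b m c d t : 1 < b -> 0 < d < b -> t < b ^ m ->
  elated b (t + pad b m c d) = d * (sumsq b t + c + d ^ 2).
Proof.
move=> b1 dP lt_t; rewrite /pad mulnDr addnA mulnA -expnD elated_lead //.
  by rewrite sumsq_cat // sumsq_repunit.
by have := repunit_lt b c b1; rewrite expnD; nia.
Qed.

(** * Identifying two numbers *)

(** Translation by [b ^ r + v - s2] sends [s2] to [b ^ r + v] and
    [s1 = s2 + (b - 1) v] to [b ^ r + b v]. *)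
Lemma sumsq_shift_eq b s1 s2 : 1 < b -> s1 = s2 %[mod b.-1] ->
  exists m, sumsq b (s1 + m) = sumsq b (s2 + m).
Proof.
move=> b1; wlog le_s : s1 s2 / s2 <= s1 => [hw eq_s|].
  case: (leqP s2 s1) => [|/ltnW] le_s; first exact: hw.
  by have [m em] := hw s2 s1 le_s (esym eq_s); exists m.
move/eqP; rewrite eqn_mod_dvd // => /dvdnP[v ev].
have es : s1 + v = s2 + b * v.
  by rewrite -(subnKC le_s) ev -addnA -mulnSr prednK ?(ltnW b1) // mulnC.
pose r := b * v + s2.
have lt_r : b * v + s2 < b ^ r by apply: ltn_expl.
have le_v : v <= b * v by rewrite leq_pmull // ltnW.
exists (b ^ r + v - s2).
have -> : s2 + (b ^ r + v - s2) = v + b ^ r * 1 by lia.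
have -> : s1 + (b ^ r + v - s2) = (0 + b ^ 1 * v) + b ^ r * 1.
  by rewrite expn1; lia.
rewrite !sumsq_cat ?expn1 ?(ltnW b1) //; [|by lia|by lia].
by rewrite [sumsq b 0]/sumsq big_ord0.
Qed.

(** The congruence amounts to [2 j + 1 = D] modulo [b - 1], which is solvable
    unless [b - 1] and [D] are both even. *)
Lemma digit_square_gap b D : 1 < b -> (odd b -> odd D) ->
  exists2 j, j < b.-1 & j.+1 ^ 2 = D + j ^ 2 %[mod b.-1].
Proof.
move=> b1 oD; have b0 : 0 < b.-1 by lia.
have [j0 ej0] : exists j0, j0.*2.+1 = D %[mod b.-1].
  case: (boolP (odd D)) => eD.
    by exists D./2; rewrite -[in RHS](odd_double_half D) eD.
  have oDb : odd (D + b.-1) by move: (negbTE eD) oD; lia.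
  exists (D + b.-1)./2; rewrite -[RHS]modnDr.
  by rewrite -[in RHS](odd_double_half (D + b.-1)) oDb.
exists (j0 %% b.-1); first by rewrite ltn_mod.
set j := j0 %% _.
have -> : j.+1 ^ 2 = j.*2.+1 + j ^ 2 by rewrite !expnS expn0 -muln2; lia.
apply/eqP; rewrite eqn_modDr -ej0 -[j.*2.+1]addn1 -[j0.*2.+1]addn1 eqn_modDr.
by rewrite -!muln2 modnMml.
Qed.

(** With [t1] translated to [(j + 1) b ^ r], the smaller number [t2] becomes
    [j b ^ r + (b ^ r - w)], where [w] is the difference; the digit [j] is
    then free to adjust the difference of the two values of [S]. *)
Lemma sumsq_shift_congr b t1 t2 : 1 < b -> (odd b -> odd t1 = odd t2) ->
  exists m, sumsq b (t1 + m) = sumsq b (t2 + m) %[mod b.-1].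
Proof.
move=> b1; wlog lt_t : t1 t2 / t2 < t1 => [hw oP|].
  case: (ltngtP t2 t1) => [lt_t|lt_t|->]; [exact: hw| |by exists 0].
  by have [m em] := hw t2 t1 lt_t (fun ob => esym (oP ob)); exists m.
move=> oP; pose r := t1; have lt_r : t1 < b ^ r by apply: ltn_expl.
pose w := t1 - t2.
have oD : odd b -> odd (sumsq b (b ^ r - w)).
  move=> ob; rewrite odd_sumsq // oddB; last by rewrite /w; lia.
  by rewrite oddX ob orbT oddB ?oP ?addbb // ltnW.
have [j lt_j ej] := digit_square_gap b _ b1 oD.
exists (b ^ r * j + b ^ r - t1).
have -> : t1 + (b ^ r * j + b ^ r - t1) = 0 + b ^ r * j.+1.
  by rewrite mulnSr; move: (b ^ r * j) (b ^ r) lt_r => p q; clear -lt_t; lia.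
have -> : t2 + (b ^ r * j + b ^ r - t1) = (b ^ r - w) + b ^ r * j.
  by rewrite /w; move: (b ^ r * j) (b ^ r) lt_r => p q; clear -lt_t; lia.
have lt_jb : j.+1 < b by rewrite -ltn_predRL.
have br0 : 0 < b ^ r by rewrite expn_gt0 ltnW.
rewrite !sumsq_cat //; last by rewrite ltn_subrL subn_gt0 lt_t.
rewrite [sumsq b 0]/sumsq big_ord0 add0n.
by rewrite (@sumsq_digit _ j.+1) // (@sumsq_digit _ j) // ltnW.
Qed.

(** * Translating finite sets to attracted numbers *)

(** For odd [b] the translated numbers are moreover required to be even; this
    is what makes the translation itself even when the elements of [T] are. *)
Definition translatable (b u : nat) (T : seq nat) : Prop :=
  exists n, {in T, forall t, attracted b u (t + n) /\ (odd b -> ~~ odd (t + n))}.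

Lemma attracted_elated b u a :
  0 < a -> attracted b u (elated b a) -> attracted b u a.
Proof. by move=> a0 [_ [k _ ek]]; split=> //; exists k.+1; rewrite // iterSr. Qed.

Lemma exp_bound b (T : seq nat) : 1 < b -> exists m, {in T, forall t, t < b ^ m}.
Proof.
move=> b1; exists (\max_(t <- T) t) => t Tt.
apply: leq_trans (ltn_expl t b1) _.
by rewrite leq_exp2l //; apply: (leq_bigmax_seq (F := id)).
Qed.

Lemma translatable1 b u t : 1 < b -> 0 < u -> ~~ odd u -> translatable b u [:: t].
Proof.
move=> b1 u0 eu; pose w := pad b t u.-1 1.
have le_w : b ^ t <= w by apply: leq_exp_pad.
have lt_t : t < b ^ t by apply: ltn_expl.
exists (w - t) => _ /[!inE]/eqP->; rewrite subnKC; last by lia.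
split; last by move=> ob; rewrite odd_pad // addn1 prednK.
split; first by lia.
exists 1 => //=; rewrite -[w]add0n elated_pad ?expn_gt0 ?b1 ?(ltnW b1) //.
by rewrite sumsq_digit ?(ltnW b1) // mul1n add0n addn1 prednK.
Qed.

Lemma translatable_image b u m (T : seq nat) : 1 < b ->
  translatable b u [seq (sumsq b (t + m)).+1 | t <- T] -> translatable b u T.
Proof.
move=> b1 [c cP]; have [k kP] := exp_bound b [seq t + m | t <- T] b1.
exists (m + pad b k c 1) => t Tt; rewrite addnA.
have [] := cP (sumsq b (t + m)).+1 (map_f _ Tt).
have le_pad : b ^ k <= pad b k c 1 by apply: leq_exp_pad.
have lt_t : t + m < b ^ k by apply/kP/map_f.
move=> att par; split.
  apply: attracted_elated; first by lia.
  by rewrite elated_pad // mul1n addn1 -addSn.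
move=> ob; move: (par ob).
by rewrite !oddD odd_pad //= odd_sumsq // !oddD /= addbT addbN addNb.
Qed.

(** Each induction step identifies the first two elements by two maps
    [t |-> S (t + m) + 1], which makes one of them redundant.  For odd [b]
    these maps send numbers of equal parity to numbers of equal parity, so the
    hypothesis is preserved. *)
Lemma translatable_same_parity b u (T : seq nat) :
  1 < b -> 0 < u -> ~~ odd u ->
  (odd b -> {in T &, forall t t', odd t = odd t'}) -> translatable b u T.
Proof.
move=> b1 u0 eu; have [k] := ubnP (size T); elim: k T => // k IHk T.
case: T => [|t1 [|t2 T]] /= lt_k par; first by exists 0.
  exact: translatable1.
have par12 : odd b -> odd t1 = odd t2.
  by move=> ob; apply: par; rewrite // !inE eqxx ?orbT.
have [m1 em1] := sumsq_shift_congr b _ _ b1 par12.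
pose f t := (sumsq b (t + m1)).+1.
have [m2 em2] : exists m2, sumsq b (f t1 + m2) = sumsq b (f t2 + m2).
  apply: sumsq_shift_eq => //.
  by rewrite /f -![(sumsq _ _).+1]addn1 -modnDml em1 modnDml.
apply: (@translatable_image _ _ m1) => //.
apply: (@translatable_image _ _ m2) => //.
pose g t := (sumsq b (f t + m2)).+1.
have odd_g t : odd b -> odd (g t) = odd (t + m1 + m2).
  move=> ob; rewrite /g /f /= odd_sumsq // oddD /= odd_sumsq //.
  by rewrite addNb negbK -oddD.
have [n nP] : translatable b u (map g (t2 :: T)).
  apply: IHk => [|ob _ _ /mapP[s Ts ->] /mapP[s' Ts' ->]].
    by rewrite /= size_map.
  rewrite !odd_g // !oddD; congr (_ (+) _ (+) _).
  by apply: par => //; apply: mem_behead.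
exists n => s; rewrite -map_comp => /mapP[t + ->].
rewrite inE => /predU1P[->|Tt].
  by rewrite /= -/(f t1) em2; apply: nP; rewrite inE eqxx.
by apply: nP; apply: (map_f g).
Qed.

Theorem theorem9 (b u : nat) (hb : 2 <= b) (hu : in_cycle b u)
    (hu_even : ~~ odd u) (L : nat) (hL : 0 < L) :
  exists2 a : nat, 0 < a & forall i : nat, i < L -> attracted b u (a + i).
Proof.
case: hu => u0 _; case: (boolP (odd b)) => ob; last first.
  have [|n nP] := @translatable_same_parity b u (iota 0 L) hb u0 hu_even.
    by rewrite (negbTE ob).
  have att i : i < L -> attracted b u (n + i).
    by move=> ltiL; rewrite addnC; have [] := nP i; rewrite // mem_iota.
  by exists n => //; have [] := att 0 hL; rewrite addn0.
have b3 : 2 < b by case: b hb ob {u0} => [|[|[|]]].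
(* [8 = 2 * 2 ^ 2] is the contribution of the leading digit [2] itself. *)
pose h t := 2 * sumsq b t + 8.
have even_h t : odd (h t) = false by rewrite oddD oddM.
have [|n nP] := @translatable_same_parity b u (map h (iota 0 L)) hb u0 hu_even.
  by move=> _ _ _ /mapP[t _ ->] /mapP[t' _ ->]; rewrite !even_h.
have inL i : i < L -> h i \in map h (iota 0 L).
  by move=> ltiL; apply: map_f; rewrite mem_iota.
have even_n : n = 2 * n./2.
  have [_ /(_ ob)] := nP _ (inL 0 hL); rewrite oddD even_h /= => en.
  by rewrite mul2n even_halfK.
have [m mP] := exp_bound b (iota 0 L) hb.
have pad0 : 0 < pad b m n./2 2.
  by apply: leq_trans (leq_exp_pad b m n./2 2 hb isT); rewrite expn_gt0 ltnW.
exists (pad b m n./2 2) => // i ltiL; rewrite addnC.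
apply: attracted_elated; first by rewrite addn_gt0 pad0 orbT.
rewrite elated_pad ?mP ?mem_iota //.
have -> : 2 * (sumsq b i + n./2 + 2 ^ 2) = h i + n by rewrite /h; lia.
by have [] := nP _ (inL i ltiL).
Qed.
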